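(* Let $X$ be a real normed space, let $C\subseteq X$ be an open convex set, let $h:C\rightarrow\mathbb{R}$ be G\^{a}teaux differentiable on $C$, and let $\gamma>0$. If $h$ is strongly quasiconvex with modulus $\gamma$, then for every $x,y\in C$ the following implication holds: $$h(x)\leq h(y)\ \Longrightarrow\ \langle\nabla h(y),y-x\rangle\geq\frac{\gamma}{2}\lVert y-x\rVert^{2}.\qquad(\ast)$$ Conversely, if $(\ast)$ holds for every $x,y\in C$, then $h$ is strongly quasiconvex with modulus $\frac{\gamma}{2}$.
   Context: A function $h:C\to\mathbb{R}$ on a convex subset $C$ of a normed space $X$ is called strongly quasiconvex with modulus $\gamma>0$ if for every $x,y\in C$ and every $t\in[0,1]$, $$h(x+t(y-x))\leq\max\{h(x),h(y)\}-\frac{\gamma}{2}t(1-t)\lVert y-x\rVert^{2}.$$ Here $\nabla h(y)\in X^{*}$ denotes the G\^{a}teaux derivative of $h$ at $y$, i.e. the continuous linear functional with $\langle\nabla h(y),a\rangle=\lim_{t\to 0}\frac{h(y+ta)-h(y)}{t}$ for all $a\in X$. *)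

(* Defs.v *)
From HB Require Import structures.
From mathcomp Require Import all_boot all_order all_algebra.
From mathcomp Require Import all_classical all_reals all_analysis.
Set Implicit Arguments.
Unset Strict Implicit.
Unset Printing Implicit Defensive.
Import Order.TTheory GRing.Theory Num.Theory.
Import numFieldNormedType.Exports.
Local Open Scope classical_set_scope.
Local Open Scope ring_scope.

(* A function C -> R is represented by a total function h : X -> R.  The notions
   below read h only on C: in strongly_quasiconvex the intermediate point lies
   in C by convexity, and the Gateaux derivative at a point of an open C depends
   only on the values of h near that point. *)

Definition strongly_quasiconvex (R : realType) (X : normedModType R)
    (C : set X) (h : X -> R) (gamma : R) : Prop :=
  forall x y : X, C x -> C y -> forall t : R, 0 <= t <= 1 ->
    h (x + t *: (y - x))
      <= Num.max (h x) (h y) - gamma / 2 * t * (1 - t) * `|y - x| ^+ 2.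

Definition is_gateaux_derivative (R : realType) (X : normedModType R)
    (h : X -> R) (y : X) (L : {linear X -> R^o}) : Prop :=
  continuous L /\
  forall a : X, (h (y + t *: a) - h y) / t @[t --> 0^'] --> (L a : R).

Definition gateaux_differentiable (R : realType) (X : normedModType R)
    (h : X -> R) (y : X) : Prop :=
  exists L : {linear X -> R^o}, is_gateaux_derivative h y L.

(* Meaningful only when h is Gateaux differentiable at y; its values
   are then determined, by uniqueness of limits. *)
Definition gateaux_derivative (R : realType) (X : normedModType R)
    (h : X -> R) (y : X) : {linear X -> R^o} :=
  get (is_gateaux_derivative h y).

(* Main.v *)
Require Import Defs.
From HB Require Import structures.
From mathcomp Require Import all_boot all_order all_algebra.
From mathcomp Require Import all_classical all_reals all_analysis.
From mathcomp Require Import ring lra.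
Import Order.TTheory GRing.Theory Num.Theory.
Import numFieldNormedType.Exports.
Local Open Scope classical_set_scope.
Local Open Scope ring_scope.

(** In both directions everything happens on a line.

    If h is strongly quasiconvex and h x <= h y, the difference quotients of h
    at y in the direction x - y are at most - gamma / 2 * (1 - t) * |y - x|^2
    for 0 < t <= 1; let t tend to 0 from the right.

    Conversely, put f t = h (x + t (y - x)) and k = gamma / 2 * |y - x|^2.
    The implication assumed of h, at two points of the segment, becomes a
    strong pseudomonotonicity of f' on [0, 1]: f s <= f t implies
    k (t - s)^2 <= f' t (t - s).  Since
    t (1 - t) = 1 / 4 - (t - 1 / 2)^2, the conclusion is that the function
    phi t = f t - k / 2 * (t - 1 / 2)^2 attains its maximum over [0, 1] at an
    end point ([max_principle_of_strong_pseudomonotone]).  Suppose that phi is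
    maximal at an interior point c.  Then f' c = k (c - 1 / 2), whereas the
    reflection of c in the midpoint satisfies f (1 - c) <= f c and so
    k (2 c - 1)^2 <= f' c (2 c - 1).  These two facts force c = 1 / 2 and
    f' c = 0, which in turn makes 1 / 2 the strict minimum of f.  But then
    f' s >= k (s - 1 / 2) for all s > 1 / 2, i.e. phi is nondecreasing on
    [1 / 2, 1] and its maximum is also attained at 1. *)

Lemma convex_set_segment (R : realType) (X : lmodType R) (C : set X)
    (x y : X) (t : R) :
  convex_set C -> C x -> C y -> 0 <= t <= 1 -> C (x + t *: (y - x)).
Proof.
move=> convC Cx Cy /andP[t0 t1].
have := convC y x (Itv01 t0 t1) (mem_set Cy) (mem_set Cx); rewrite inE.
congr (C _).
by rewrite /conv/= /unstable.onem scalerBl scale1r scalerBr [RHS]addrC -addrA [- _ + x]addrC.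
Qed.

Lemma gateaux_derivativeP (R : realType) (X : normedModType R) (h : X -> R)
    (y : X) :
  gateaux_differentiable h y ->
  is_gateaux_derivative h y (gateaux_derivative h y).
Proof. by move=> [L hL]; exact: (@getPex _ _ (ex_intro _ L hL)). Qed.

(** Reduces the study of h on a segment to that of a real function to which
    the extreme value and mean value theorems apply. *)
Lemma is_derive_along_line (R : realType) (X : normedModType R) (h : X -> R)
    (x v : X) (t : R) :
  gateaux_differentiable h (x + t *: v) ->
  is_derive t 1 (fun s : R => h (x + s *: v))
    (gateaux_derivative h (x + t *: v) v : R).
Proof.
move=> /gateaux_derivativeP[_ /(_ v)] q.
have {}q : (fun s : R => s^-1 *: (((fun s : R => h (x + s *: v)) \o shift t)
    (s *: 1) - h (x + t *: v))) @ 0^' -->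
    (gateaux_derivative h (x + t *: v) v : R).
  apply: cvg_trans q; apply: near_eq_cvg; near=> s.
  have -> : s *: (1 : R) = s by exact: mulr1.
  by rewrite /= scalerDl [s *: v + _]addrC addrA mulrC.
by split; [apply/cvg_ex; eexists; exact: q | exact: cvg_lim q].
Unshelve. all: by end_near.
Qed.

(** Subtracting k / 2 * (t - 1 / 2)^2, which differs from - k / 2 * t (1 - t)
    by a constant, turns the claim into a maximum principle for phi; the centre
    1 / 2 makes the correction invariant under t |-> 1 - t, so that a maximum
    of phi at c can be compared with the value of f at 1 - c. *)
Lemma max_principle_of_strong_pseudomonotone (R : realType) (f f' : R -> R)
    (k : R) :
  0 < k ->
  (forall t : R, 0 <= t <= 1 -> is_derive t 1 f (f' t)) ->
  (forall s t : R, 0 <= s <= 1 -> 0 <= t <= 1 -> f s <= f t ->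
     k * (t - s) ^+ 2 <= f' t * (t - s)) ->
  forall t : R, 0 <= t <= 1 -> f t <= Num.max (f 0) (f 1) - k / 2 * t * (1 - t).
Proof.
move=> k0 df mono.
pose phi (t : R) := f t - k / 2 * (t - 2^-1) ^+ 2.
have dphi (t : R) : 0 <= t <= 1 -> is_derive t 1 phi (f' t - k * (t - 2^-1)).
  move=> /df dft; rewrite /phi; apply: is_derive_eq.
  by rewrite /GRing.scale/=; field.
have cphi (a b : R) : 0 <= a -> b <= 1 -> {within `[a, b], continuous phi}.
  move=> a0 b1; apply: derivable_within_continuous => s.
  by rewrite in_itv/= => sab; apply/ex_derive/dphi; lra.
suff phi_le : forall t : R, 0 <= t <= 1 -> phi t <= Num.max (phi 0) (phi 1).
  move=> t /phi_le; rewrite /phi lerBrDr !le_max => /orP[] ?; apply/orP.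
    by left; lra.
  by right; lra.
have [c] := EVT_max ler01 (cphi 0 1 (lexx _) (lexx _)).
rewrite in_itv/= => c01 cmax t t01.
apply: (le_trans (cmax t _)); first by rewrite in_itv.
rewrite le_max.
have [->|c0] := eqVneq c 0; first by rewrite lexx.
have [->|c1] := eqVneq c 1; first by rewrite lexx orbT.
have f'c : f' c = k * (c - 2^-1).
  have c_in : c \in `]0, 1[ by rewrite in_itv/= !lt_def [1 == c]eq_sym c1 c0.
  have -> : f' c = (f' c - k * (c - 2^-1)) + k * (c - 2^-1) by ring.
  have [_ <-] := dphi c c01.
  suff [_ ->] : is_derive c 1 phi 0 by rewrite add0r.
  apply: (derive1_at_max ler01) c_in _ => s; rewrite in_itv/= => s01.
    by apply/ex_derive/dphi; lra.
  by apply: cmax; rewrite in_itv/=; lra.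
(* The two quadratic corrections agree at c and 1 - c, hence f (1 - c) <= f c;
   pseudomonotonicity then asks for twice the slope that f has at c. *)
have c_half : c = 2^-1.
  have frefl : f (1 - c) <= f c.
    have /cmax : 1 - c \in `[0, 1] by rewrite in_itv/=; lra.
    by rewrite /phi; lra.
  have := mono _ _ _ c01 frefl; rewrite f'c => /(_ ltac:(lra)) H.
  have : (c - 2^-1) ^+ 2 <= 0 by rewrite -(ler_pM2l k0); lra.
  by rewrite le_eqVlt ltNge sqr_ge0 orbF sqrf_eq0 => /eqP; lra.
subst c; rewrite subrr mulr0 in f'c.
have fmin (s : R) : 0 <= s <= 1 -> f 2^-1 <= f s.
  move=> s01; rewrite leNgt; apply/negP => fs.
  have := mono _ _ s01 c01 (ltW fs); rewrite f'c mul0r => H.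
  have : (2^-1 - s) ^+ 2 <= 0 by rewrite -(ler_pM2l k0); lra.
  by rewrite le_eqVlt ltNge sqr_ge0 orbF sqrf_eq0 => /eqP/subr0_eq se; rewrite -se ltxx in fs.
(* Since 1 / 2 minimises f, it can serve as the base point s of the hypothesis
   at every t > 1 / 2, which says that phi has a nonnegative slope there. *)
have half1 : 2^-1 < 1 :> R by lra.
have dphi_right (s : R) : s \in `]2^-1, 1[ ->
    is_derive s 1 phi (f' s - k * (s - 2^-1)).
  by rewrite in_itv/= => s01; apply: dphi; lra.
have half_ge0 : 0 <= 2^-1 :> R by lra.
have [s] := MVT half1 dphi_right (cphi 2^-1 1 half_ge0 (lexx _)).
rewrite in_itv/= => s01 /eqP; rewrite subr_eq => /eqP ->.
have := mono 2^-1 s c01 _ (fmin s _) => /(_ ltac:(lra) ltac:(lra)) H.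
have {}H : k * (s - 2^-1) <= f' s.
  by rewrite -(@ler_pM2r _ (s - 2^-1)); lra.
by apply/orP; right; rewrite lerDr mulr_ge0; lra.
Qed.

(** The gain gamma / 2 * t (1 - t) |y - x|^2, divided by t, survives the limit
    t -> 0+; the limit is taken from the right because dividing by a negative t
    would reverse the inequality. *)
Lemma strongly_quasiconvex_derivative (R : realType) (X : normedModType R)
    (C : set X) (h : X -> R) (gamma : R) (x y : X) :
  strongly_quasiconvex C h gamma -> C x -> C y ->
  gateaux_differentiable h y -> h x <= h y ->
  gamma / 2 * `|y - x| ^+ 2 <= gateaux_derivative h y (y - x).
Proof.
move=> sqc Cx Cy /gateaux_derivativeP[_ /(_ (x - y))] q hxy.
set d := `|y - x| ^+ 2.
rewrite -[y - x]opprB linearN /= lerNr.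
have {}q : (h (y + t *: (x - y)) - h y) / t @[t --> 0^'+] -->
    (gateaux_derivative h y (x - y) : R).
  exact: cvg_dnbhs_at_right q.
have bound : - (gamma / 2 * (1 - t) * d) @[t --> 0^'+] --> - (gamma / 2 * d).
  apply: cvg_at_right_filter.
  rewrite [X in _ --> - X](_ : _ = gamma / 2 * (1 - 0) * d); last by ring.
  apply: cvgN; apply: cvgM; last exact: cvg_cst.
  by apply: cvgM; [exact: cvg_cst | apply: cvgB; [exact: cvg_cst | exact: cvg_id]].
apply: (ler_cvg_to q bound).
near=> t.
have t0 : 0 < t by near: t; exact: nbhs_right_gt.
have t1 : t <= 1 by near: t; exact: nbhs_right_le.
rewrite ler_pdivrMr//.
have := sqc y x Cy Cx t; rewrite (ltW t0) t1 (max_idPl hxy) distrC => /(_ isT).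
by rewrite -/d; lra.
Unshelve. all: by end_near.
Qed.

Theorem corollary8 (R : realType) (X : normedModType R) (C : set X)
    (h : X -> R) (gamma : R)
    (openC : open C) (convexC : convex_set C)
    (diffh : forall y : X, C y -> gateaux_differentiable h y)
    (gamma_gt0 : 0 < gamma) :
  (strongly_quasiconvex C h gamma ->
     forall x y : X, C x -> C y -> h x <= h y ->
       gamma / 2 * `|y - x| ^+ 2 <= gateaux_derivative h y (y - x)) /\
  ((forall x y : X, C x -> C y -> h x <= h y ->
      gamma / 2 * `|y - x| ^+ 2 <= gateaux_derivative h y (y - x)) ->
     strongly_quasiconvex C h (gamma / 2)).
Proof.
split=> [sqc x y Cx Cy|star x y Cx Cy t t01].
  exact: (strongly_quasiconvex_derivative _ _ _ _ _ _ _ sqc Cx Cy (diffh y Cy)).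
have [->|xy] := eqVneq x y.
  by rewrite subrr scaler0 addr0 normr0 expr0n mulr0 subr0 maxxx.
have k0 : 0 < gamma / 2 * `|y - x| ^+ 2.
  by rewrite mulr_gt0 ?divr_gt0 ?exprn_gt0// normr_gt0 subr_eq0 eq_sym.
have Cseg (s : R) : 0 <= s <= 1 -> C (x + s *: (y - x)).
  exact: convex_set_segment.
pose f (s : R) := h (x + s *: (y - x)).
pose f' (s : R) : R := gateaux_derivative h (x + s *: (y - x)) (y - x).
have df (s : R) : 0 <= s <= 1 -> is_derive s 1 f (f' s).
  by move=> /Cseg/diffh; exact: is_derive_along_line.
have mono (s r : R) : 0 <= s <= 1 -> 0 <= r <= 1 -> f s <= f r ->
    gamma / 2 * `|y - x| ^+ 2 * (r - s) ^+ 2 <= f' r * (r - s).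
  move=> /Cseg Cs /Cseg Cr fsr; have := star _ _ Cs Cr fsr.
  have -> : x + r *: (y - x) - (x + s *: (y - x)) = (r - s) *: (y - x).
    by rewrite [x + r *: _]addrC addrKA -scalerBl.
  rewrite linearZ/= normrZ exprMn real_normK ?num_real// mulrCA mulrC.
  by rewrite [f' r * _]mulrC.
have := max_principle_of_strong_pseudomonotone _ _ _ _ k0 df mono t t01.
rewrite /f scale0r addr0 scale1r subrKC => /le_trans; apply.
by rewrite le_eqVlt; apply/orP; left; apply/eqP; congr (_ - _); field.
Qed.
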